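(* Let $M\subseteq\mathbb{T}$ satisfy the standing hypothesis. The complete core $\mathrm{core}_{\curvearrowleft}(\rho^\forall_M)$ of the universal closure for time reversal exists, its set of fixpoints is $\{Y\subseteq\mathbb{T}\mid Y\text{ and }\curvearrowleft Y\text{ are both fixpoints of }\rho^\forall_M\}$, and $\mathrm{core}_{\curvearrowleft}(\rho^\forall_M)=\rho^\forall_M\sqcup\rho^\forall_{\curvearrowleft M}$.
   Context: $\mathbb{T}$ is the set of traces $\langle i,\sigma\rangle$, $i\in\mathbb{Z}$, $\sigma:\mathbb{Z}\to\mathbb{S}$; $X_{\downarrow s}=\{\langle i,\sigma\rangle\in X\mid\sigma_i=s\}$; $\oplus(X)=\{\langle i,\sigma\rangle\mid\langle i+1,\sigma\rangle\in X\}$, $\ominus(X)=\{\langle i,\sigma\rangle\mid\langle i-1,\sigma\rangle\in X\}$, $\curvearrowleft(X)=\{\langle -i,\lambda k.\sigma_{-k}\rangle\mid\langle i,\sigma\rangle\in X\}$. Standing hypothesis on $M$: (i) $|M_{\downarrow s}|>1$ for all $s$; (ii) $\oplus(M)=M=\ominus(M)$ and $\oplus(\curvearrowleft M)=\curvearrowleft M=\ominus(\curvearrowleft M)$. For a model $N$, $\rho^\forall_N(X)=\{\langle i,\sigma\rangle\in N\mid N_{\downarrow\sigma_i}\subseteq X\}$. Upper closure operators on $\langle\wp(\mathbb{T}),\supseteq\rangle$: maps monotone w.r.t. $\subseteq$, idempotent, with $\rho(X)\subseteq X$; ordered by $\rho\sqsubseteq\eta$ iff $\rho(X)\supseteq\eta(X)$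 for all $X$; identified with their sets of fixpoints; the lub $\rho\sqcup\eta$ is the closure whose set of fixpoints is the intersection of their sets of fixpoints. $\rho$ is complete for $f$ if $\rho\circ f=\rho\circ f\circ\rho$. The complete core of $\rho$ for $f$ is the $\sqsubseteq$-least closure $\eta$ with $\rho\sqsubseteq\eta$ complete for $f$. *)

(* Defs.v *)
From HB Require Import structures.
From mathcomp Require Import all_boot all_order all_algebra.
From mathcomp Require Import boolp classical_sets functions cardinality.

Set Implicit Arguments.
Unset Strict Implicit.
Unset Printing Implicit Defensive.

Import GRing.Theory.

Local Open Scope classical_set_scope.
Local Open Scope ring_scope.

(** Upper closure operators on the complete lattice of sets ordered by reverse
    inclusion: extensivity for that order is [rho X `<=` X]. *)

Record uco (T : Type) := Uco {
  uco_fun :> set T -> set T;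
  uco_mono : forall X Y : set T, X `<=` Y -> uco_fun X `<=` uco_fun Y;
  uco_idem : forall X : set T, uco_fun (uco_fun X) = uco_fun X;
  uco_red : forall X : set T, uco_fun X `<=` X }.

Definition uco_le (T : Type) (rho eta : uco T) : Prop :=
  forall X : set T, eta X `<=` rho X.

Definition fixpoints (T : Type) (rho : uco T) : set (set T) :=
  [set X | rho X = X].

Definition complete_for (T : Type) (f : set T -> set T) (rho : uco T) : Prop :=
  rho \o f = rho \o f \o rho.

Definition is_complete_core (T : Type) (f : set T -> set T) (rho eta : uco T) :
    Prop :=
  [/\ uco_le rho eta, complete_for f eta &
      forall mu : uco T, uco_le rho mu -> complete_for f mu -> uco_le eta mu].

Lemma uco_ext (T : Type) (rho eta : uco T) :
  (forall X, rho X = eta X) -> rho = eta.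
Proof.
case: rho eta => [f fm fi fr] [g gm gi gr] /= /funext fg.
case: _ / fg gm gi gr => gm gi gr.
by congr Uco; exact: Prop_irrelevance.
Qed.

Section Join.
Variables (T : Type) (rho eta : uco T).

Definition uco_join_fun (X : set T) : set T :=
  \bigcup_(Y in [set Y | Y `<=` X /\ (fixpoints rho `&` fixpoints eta) Y]) Y.

Let join_mono X Y : X `<=` Y -> uco_join_fun X `<=` uco_join_fun Y.
Proof.
by move=> XY x [Z [ZX fZ] Zx]; exists Z => //; split=> //; apply: subset_trans XY.
Qed.

Let join_red X : uco_join_fun X `<=` X.
Proof. by move=> x [Z [ZX _]]; exact: ZX. Qed.

Let join_idem X : uco_join_fun (uco_join_fun X) = uco_join_fun X.
Proof.
apply/seteqP; split; first exact: join_red.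
move=> x [Z [ZX fZ] Zx]; exists Z => //; split=> // z Zz.
by exists Z.
Qed.

Definition uco_join : uco T := Uco join_mono join_idem join_red.

Lemma fixpoints_join : fixpoints uco_join = fixpoints rho `&` fixpoints eta.
Proof.
apply/seteqP; split=> [X /= fX|X fX]; last first.
  rewrite /fixpoints /=; apply/seteqP; split; first exact: join_red.
  by move=> x Xx; exists X => //; split=> //; exact: subset_refl.
split; rewrite /fixpoints /=; apply/seteqP; split; try exact: uco_red;
  rewrite -{1}fX => x [Z [ZX [rZ eZ]] Zx].
- by apply: (uco_mono ZX); rewrite rZ.
- by apply: (uco_mono ZX); rewrite eZ.
Qed.

Lemma uco_join_lub (mu : uco T) :
  uco_le uco_join mu <-> uco_le rho mu /\ uco_le eta mu.
Proof.
split=> [jm|[rm em] X x mx].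
  split=> X x /jm [Z [ZX [rZ eZ]] Zx].
  - by apply: (uco_mono ZX); rewrite rZ.
  - by apply: (uco_mono ZX); rewrite eZ.
exists (mu X) => //; split; first exact: uco_red.
split; rewrite /fixpoints /=; apply/seteqP; split; try exact: uco_red;
  rewrite -{1}uco_idem.
- exact: rm.
- exact: em.
Qed.

End Join.

Section Traces.
Variable S : Type.

Definition trace : Type := (int * (int -> S))%type.

Definition present (t : trace) : S := t.2 t.1.

Definition at_state (X : set trace) (s : S) : set trace :=
  [set t | X t /\ present t = s].

Definition nexttime (X : set trace) : set trace := [set t | X (t.1 + 1, t.2)].

Definition prevtime (X : set trace) : set trace := [set t | X (t.1 - 1, t.2)].

Definition rev_trace (t : trace) : trace := (- t.1, fun k => t.2 (- k)).

Definition reversal (X : set trace) : set trace := rev_trace @` X.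

Definition model_hyp (M : set trace) : Prop :=
  [/\ forall s : S, ~ (at_state M s #<= `I_1)%card,
      nexttime M = M, prevtime M = M,
      nexttime (reversal M) = reversal M & prevtime (reversal M) = reversal M].

Definition univ_fun (N X : set trace) : set trace :=
  [set t | N t /\ at_state N (present t) `<=` X].

Lemma univ_mono (N X Y : set trace) :
  X `<=` Y -> univ_fun N X `<=` univ_fun N Y.
Proof. by move=> XY t [Nt tX]; split=> //; apply: subset_trans XY. Qed.

Lemma univ_red (N X : set trace) : univ_fun N X `<=` X.
Proof. by move=> t [Nt]; apply. Qed.

Lemma univ_idem (N X : set trace) : univ_fun N (univ_fun N X) = univ_fun N X.
Proof.
apply/seteqP; split; first exact: univ_red.
by move=> t [Nt tX]; split=> // u [Nu ut]; split=> //; rewrite ut.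
Qed.

Definition univ_closure (N : set trace) : uco trace :=
  Uco (@univ_mono N) (univ_idem N) (@univ_red N).

End Traces.

(* Main.v *)
Require Import Defs.
From mathcomp Require Import all_boot all_order all_algebra.
From mathcomp Require Import boolp classical_sets functions cardinality.

Local Open Scope classical_set_scope.

(** Time reversal [f] is a monotone involution that preserves the present
    state, so it conjugates the universal closure of [M] to that of its
    reversal.  For any closure [rho] and its conjugate under a monotone
    involution [f], the fixpoints of the join are the [Y] such that [Y] and
    [f Y] are fixpoints of [rho]; this family is stable under [f], which gives
    completeness.  Conversely, the fixpoints of a closure complete for [f] are
    stable under [f], which gives minimality. *)

Section Involution.
Variables (T : Type) (f : set T -> set T).
Hypotheses (f_mono : forall X Y, X `<=` Y -> f X `<=` f Y)
           (f_invol : forall X, f (f X) = X).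

(** Completeness evaluated at [f Z] reads [Z = mu (f (mu (f Z)))], so [Z] lies in [f (mu (f Z))];
    applying [f] puts [f Z] below [mu (f Z)]. *)
Lemma complete_for_involution_fixpoints (mu : uco T) (Z : set T) :
  complete_for f mu -> fixpoints mu Z -> fixpoints mu (f Z).
Proof.
move=> cmu muZ; apply/seteqP; split; first exact: uco_red.
have /= := congr1 (fun g => g (f Z)) cmu; rewrite f_invol muZ => Zeq.
rewrite -[X in _ `<=` X]f_invol; apply: f_mono; rewrite {1}Zeq.
exact: uco_red.
Qed.

Lemma fixpoints_complete_for_involution (eta : uco T) :
  (forall Z, fixpoints eta Z -> fixpoints eta (f Z)) -> complete_for f eta.
Proof.
move=> fix_f; apply/funext => X /=; apply/seteqP; split; last first.
  by apply: uco_mono; apply: f_mono; exact: uco_red.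
(* With [Z = eta (f X)], the set [f Z] is a fixpoint contained in [X], hence in [eta X]; thus [Z] is
   contained in [f (eta X)]. *)
have fixZ : fixpoints eta (eta (f X)) by exact: uco_idem.
rewrite -{1}(uco_idem eta (f X)); apply: uco_mono.
rewrite -[X in X `<=` _]f_invol; apply: f_mono.
rewrite -(fix_f _ fixZ); apply: uco_mono.
rewrite -[X in _ `<=` X]f_invol; apply: f_mono; exact: uco_red.
Qed.

Variables rho rho' : uco T.
Hypothesis rho'_conj : forall X, rho' (f X) = f (rho X).

Lemma fixpoints_conjugate (Y : set T) :
  fixpoints rho' Y <-> fixpoints rho (f Y).
Proof.
rewrite /fixpoints /= -{1 2}(f_invol Y) rho'_conj.
by split=> [/(congr1 f)|->//]; rewrite !f_invol.
Qed.

Lemma fixpoints_join_conjugate :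
  fixpoints (uco_join rho rho') =
    [set Y | fixpoints rho Y /\ fixpoints rho (f Y)].
Proof.
rewrite fixpoints_join; apply/seteqP.
by split=> Y [rY r'Y]; split=> //; apply/fixpoints_conjugate.
Qed.

Lemma complete_core_involution :
  is_complete_core f rho (uco_join rho rho').
Proof.
have [rho_le _] := (uco_join_lub rho rho' (uco_join rho rho')).1
  (fun X => @subset_refl _ _).
split=> // [|mu rho_mu cmu].
  apply: fixpoints_complete_for_involution => Z.
  by rewrite fixpoints_join_conjugate /= f_invol => -[].
apply/uco_join_lub; split=> // X.
(* Fixpoints of [mu] are fixpoints of [rho]; as [f (mu X)] is one, conjugation makes [mu X] a
   fixpoint of [rho'] inside [X]. *)
have fix_f := complete_for_involution_fixpoints _ _ cmu (uco_idem mu X).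
have /fixpoints_conjugate <- : fixpoints rho (f (mu X)).
  apply/seteqP; split; first exact: uco_red.
  by rewrite -{1}fix_f; exact: rho_mu.
by apply: uco_mono; exact: uco_red.
Qed.

End Involution.

Section Reversal.
Variable S : Type.

Lemma rev_traceK : involutive (@rev_trace S).
Proof.
move=> [i s]; rewrite /rev_trace /= GRing.opprK; congr pair.
by apply/funext => k; rewrite GRing.opprK.
Qed.

Lemma present_rev_trace (t : trace S) : present (rev_trace t) = present t.
Proof. by rewrite /present /= GRing.opprK. Qed.

(** As [rev_trace] is its own inverse, images become preimages, whose membership unfolds without a
    witness. *)
Lemma reversal_preimage (X : set (trace S)) :
  reversal X = @rev_trace S @^-1` X.
Proof.
apply/seteqP; split=> [_ [t Xt <-]|t Xt] /=; first by rewrite rev_traceK.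
by exists (rev_trace t) => //; rewrite rev_traceK.
Qed.

Lemma reversalK : involutive (@reversal S).
Proof.
move=> X; rewrite !reversal_preimage; apply/seteqP.
by split=> t /=; rewrite rev_traceK.
Qed.

Lemma reversal_mono (X Y : set (trace S)) :
  X `<=` Y -> reversal X `<=` reversal Y.
Proof. exact: image_subset. Qed.

(** For each state [s], [rev_trace] maps [at_state M s] bijectively onto
    [at_state (reversal M) s]. *)
Lemma univ_closure_reversal (M X : set (trace S)) :
  univ_closure (reversal M) (reversal X) = reversal (univ_closure M X).
Proof.
rewrite !reversal_preimage; apply/seteqP; split=> t [Mt tX]; split=> // u.
  move=> [Mu ut]; rewrite -(rev_traceK u); apply: tX.
  split; first by rewrite /= rev_traceK.
  by rewrite present_rev_trace ut present_rev_trace.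
by move=> [Mu ut]; apply: tX; split=> //; rewrite ?present_rev_trace.
Qed.

End Reversal.

Theorem theorem11 (S : Type) (M : set (trace S)) (hM : model_hyp M) :
  exists core : uco (trace S),
    [/\ is_complete_core (@reversal S) (univ_closure M) core,
        fixpoints core =
          [set Y : set (trace S) | fixpoints (univ_closure M) Y /\
                                   fixpoints (univ_closure M) (reversal Y)] &
        core = uco_join (univ_closure M) (univ_closure (reversal M))].
Proof.
exists (uco_join (univ_closure M) (univ_closure (reversal M))); split=> //.
  apply: complete_core_involution; first exact: reversal_mono.
    exact: reversalK.
  exact: univ_closure_reversal.
apply: fixpoints_join_conjugate; first exact: reversalK.
exact: univ_closure_reversal.
Qed.
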